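(* Any instance of Boolean satisfiability (a formula in conjunctive normal form) can be reduced in polynomial time and space to an instance of Needy-Node Hyper-st-Cut; that is, one can construct in polynomial time and space an instance of Needy-Node Hyper-st-Cut whose minimum value is $0$ if and only if the formula is satisfiable.
   Context: Needy-Node Hyper-st-Cut: given a hypergraph $\mathcal{H}=(V,E)$ (finite $V$, hyperedges subsets of $V$), distinct $s,t\in V$, and for each hyperedge $e$ a designated node $z_e\in e$ (the needy node), define the splitting function $\mathbf{w}_e(S)=1$ if $z_e$ is clustered by itself, i.e. $S\cap e=\{z_e\}$ or $e\setminus S=\{z_e\}$, and $\mathbf{w}_e(S)=0$ otherwise. The problem is to minimize $\sum_{e\in E}\mathbf{w}_e(e\cap S)$ over $S\subseteq V$ with $s\in S$, $t\notin S$. *)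

(* Defs.v *)
From HB Require Import structures.
From mathcomp Require Import all_boot all_order all_algebra finmap.

Set Implicit Arguments.
Unset Strict Implicit.
Unset Printing Implicit Defensive.

Local Open Scope fset_scope.

Variant move := MoveL | MoveR | Stay.

Section Tape.
Variable G : Type.
Variable blank : G.

(* Tapes are infinite in both directions.  In [Tape l a r] the head reads a;  *)
(* l is the part of the tape to its left,     *)
(* listed from the head outwards, and r the part to its right.  The cells     *)
(* not listed are blank and have never been visited.                          *)
Record tape := Tape { tape_left : seq G; tape_head : G; tape_right : seq G }.

Definition tape_of (s : seq G) : tape := Tape [::] (head blank s) (behead s).

Definition tape_write (a : G) (t : tape) : tape :=
  Tape (tape_left t) a (tape_right t).

Definition tape_move (m : move) (t : tape) : tape :=
  let: Tape l a r := t in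
  match m with
  | MoveL => Tape (behead l) (head blank l) (a :: r)
  | MoveR => Tape (a :: l) (head blank r) (behead r)
  | Stay => t
  end.

Definition tape_content (t : tape) : seq G :=
  rev (tape_left t) ++ tape_head t :: tape_right t.

End Tape.

Section TuringMachine.
Variable A : finType.

(* The tape alphabet extends the input/output alphabet A by finitely many     *)
(* work symbols and by the blank None.  There are tm_tapes.+1 tapes: the      *)
(* input is read from the first one and the output is left on the last one.   *)
Record tm := TM {
  tm_state : finType;
  tm_work : finType;
  tm_tapes : nat;
  tm_start : tm_state;
  tm_halt : pred tm_state;
  tm_delta : tm_state -> {ffun 'I_tm_tapes.+1 -> option (A + tm_work)} ->
             tm_state * {ffun 'I_tm_tapes.+1 -> option (A + tm_work) * move}
}.

Variable M : tm.

Definition tm_symbol := option (A + tm_work M).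

Definition letter (a : A) : tm_symbol := Some (inl a).

Record config := Config {
  cfg_state : tm_state M;
  cfg_tapes : 'I_(tm_tapes M).+1 -> tape tm_symbol
}.

Definition init (w : seq A) : config :=
  Config (tm_start M)
    (fun i => tape_of None (if i == ord0 then map letter w else [::])).

Definition halted (c : config) : bool := tm_halt (cfg_state c).

Definition step (c : config) : config :=
  if halted c then c else
  let: (q, act) :=
    tm_delta (cfg_state c) [ffun i => tape_head (cfg_tapes c i)] in
  Config q (fun i =>
    tape_move None (act i).2 (tape_write (act i).1 (cfg_tapes c i))).

Definition run (w : seq A) (n : nat) : config := iter n step (init w).

Definition space (c : config) : nat :=
  \sum_i size (tape_content (cfg_tapes c i)).

Definition outputs (c : config) (w : seq A) : Prop :=
  exists i j, tape_content (cfg_tapes c ord_max) =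
              nseq i None ++ map letter w ++ nseq j None.

End TuringMachine.

(* [denotes w y] means that w is a description of y; an object may have       *)
(* several descriptions, and the machine has to produce one of them.          *)
Definition poly_time_space_computable (A : finType) (X Y : Type)
    (encode : X -> seq A) (denotes : seq A -> Y -> Prop) (f : X -> Y) : Prop :=
  exists (M : tm A) (p q : {poly nat}), forall x : X,
  exists (T : nat) (w : seq A),
    [/\ halted (run M (encode x) T),
        T <= p.[size (encode x)]%R,
        forall n, space (run M (encode x) n) <= q.[size (encode x)]%R,
        outputs (run M (encode x) T) w
      & denotes w (f x)].

(* Boolean variables and vertices are named by bit strings.                   *)
Definition ident := seq bool.

(* The literal (true, x) is x and (false, x) is its negation.                 *)
Definition literal := (bool * ident)%type.
Definition clause := seq literal.
Definition cnf := seq clause.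

Definition satisfies (a : ident -> bool) (phi : cnf) : bool :=
  all (has (fun l : literal => a l.2 == l.1)) phi.

Definition satisfiable (phi : cnf) : Prop := exists a, satisfies a phi.

Record needy_instance := NeedyInstance {
  vertices : {fset ident};
  edges : {fset {fset ident}};
  source : ident;
  sink : ident;
  needy : {fset ident} -> ident;
  edges_sub : forall e, e \in edges -> e `<=` vertices;
  source_in : source \in vertices;
  sink_in : sink \in vertices;
  source_neq_sink : source != sink;
  needy_in : forall e, e \in edges -> needy e \in e
}.

Section NeedyCut.
Variable I : needy_instance.

Definition splitting (e B : {fset ident}) : nat :=
  (B == [fset needy I e]) || (e `\` B == [fset needy I e]).

Definition cut_value (S : {fset ident}) : nat :=
  \sum_(e <- edges I) splitting e (e `&` S).

(* The default value of the minimum is that of the feasible set {source}.     *)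
Definition min_cut_value : nat :=
  \big[minn/cut_value [fset source I]]_(S <- fpowerset (vertices I)
       | (source I \in S) && (sink I \notin S)) cut_value S.

End NeedyCut.

Variant symbol := Bit of bool | Sign of bool | Vertex | Sep.

Definition symbol_code (a : symbol) : bool + bool + bool :=
  match a with
  | Bit b => inl (inl b) | Sign b => inl (inr b)
  | Vertex => inr true | Sep => inr false
  end.

Definition symbol_decode (c : bool + bool + bool) : symbol :=
  match c with
  | inl (inl b) => Bit b | inl (inr b) => Sign b
  | inr true => Vertex | inr false => Sep
  end.

Lemma symbol_codeK : cancel symbol_code symbol_decode.
Proof. by case=> []. Qed.

HB.instance Definition _ := Finite.copy symbol (can_type symbol_codeK).

Definition literal_word (l : literal) : seq symbol :=
  Sign l.1 :: map Bit l.2.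

Definition clause_word (c : clause) : seq symbol :=
  flatten (map literal_word c) ++ [:: Sep].

Definition cnf_word (phi : cnf) : seq symbol := flatten (map clause_word phi).

Definition vertex_word (v : ident) : seq symbol := Vertex :: map Bit v.

Definition vertices_word (vs : seq ident) : seq symbol :=
  flatten (map vertex_word vs) ++ [:: Sep].

Definition vertex_set (vs : seq ident) : {fset ident} := [fset v in vs].

(* A set is described by listing its elements, in any order and possibly with *)
(* repetitions.  The word of an instance lists the vertices, then the source  *)
(* and the sink, then each hyperedge preceded by its needy vertex.            *)
Definition denotes_instance (w : seq symbol) (I : needy_instance) : Prop :=
  exists (vs : seq ident) (es : seq (ident * seq ident)),
    [/\ w = vertices_word vs ++ vertices_word [:: source I; sink I] ++
            flatten [seq vertices_word (e.1 :: e.2) | e <- es],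
        vertices I = vertex_set vs,
        edges I = [fset vertex_set e.2 | e : ident * seq ident in es]
      & {in es, forall e, needy I (vertex_set e.2) = e.1}].

(* Main.v *)
(* Source and sink play the roles of true and false, and each variable x has  *)
(* two vertices, for x and for its negation.  A hyperedge with needy node s   *)
(* costs nothing iff some other node lies on the side of s, so {s} together   *)
(* with the literals of a clause encodes the clause, while {t, x, not x} with *)
(* needy node t says that x and not x are not both true.  Both may be false:  *)
(* the assignment read off the cut then makes x false.  No two of these       *)
(* hyperedges coincide with different needy nodes, because only the clause    *)
(* hyperedges contain s.                                                      *)
(*   The description of this instance is written by a two-way finite-state    *)
(* transducer in a linear number of steps, and such a transducer is simulated *)
(* by a two-tape Turing machine.                                              *)

From HB Require Import structures.
From mathcomp Require Import all_boot all_order all_algebra finmap.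
From mathcomp Require Import zify.
Require Import Defs.

Set Implicit Arguments.
Unset Strict Implicit.
Unset Printing Implicit Defensive.


(** Correctness: as [s] lies in [S] and [t] outside, a needy [s] is isolated only when no other node
    of its hyperedge is in [S], a needy [t] only when all others are. So in a cut of value 0 every
    clause has a literal in [S] and no variable has both literals there; making x true when its
    positive literal is in [S] satisfies the formula, and conversely the source together with the
    true literals forms a zero cut ([min_cut_value_eq0], [reduction_correct]). Complexity: a
    transducer step appends a word of bounded length, hence costs boundedly many machine steps, and
    a machine running in linear time uses linear space ([linear_transducer_computable]). The
    reduction needs three sweeps of the input with backtracking over one variable name at a time,
    hence linearly many steps ([reduction_run]). *)

(** * Space is bounded by time *)

Section Space.
Variables (A : finType) (M : tm A).

Lemma size_tape_content G (t : tape G) :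
  size (tape_content t) = (size (tape_left t) + size (tape_right t)).+1.
Proof. by rewrite size_cat size_rev /= addnS. Qed.

Lemma size_tape_move G (b : G) m t :
  size (tape_content (tape_move b m t)) <= (size (tape_content t)).+1.
Proof.
case: t => l a r; rewrite !size_tape_content.
by case: m => //=; rewrite size_behead; lia.
Qed.

Lemma space_step (c : config M) : space (step c) <= space c + (tm_tapes M).+1.
Proof.
rewrite /step; case: ifP => _; first exact: leq_addr.
case: tm_delta => q act.
apply: (@leq_trans (\sum_i (size (tape_content (cfg_tapes c i)) + 1))).
  apply: leq_sum => i _.
  rewrite addn1; apply: leq_trans (size_tape_move None _ _) _.
  by rewrite !size_tape_content.
by rewrite big_split /= sum1_card card_ord.
Qed.

(** A tape gains at most one cell per step; the extra 1 in [n.+1] pays for the cell under each head,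
    counted even on an empty tape. *)
Lemma space_run w n : space (run M w n) <= size w + (tm_tapes M).+1 * n.+1.
Proof.
elim: n => [|n IHn]; last first.
  by rewrite mulnS addnCA addnC (leq_trans (space_step _)) // leq_add2r.
rewrite muln1 /space (bigD1 ord0) //= size_behead size_map.
rewrite (eq_bigr (fun=> 1)) => [|i /negPf /= -> //].
by rewrite sum1_card cardC1 card_ord /=; lia.
Qed.

Lemma run_halted w T n : halted (run M w T) -> T <= n -> run M w n = run M w T.
Proof.
move=> hT /subnKC <-; elim: (n - T) => [|k IHk]; first by rewrite addn0.
by rewrite addnS {1}/run iterS -/(run M w (T + k)) IHk /step hT.
Qed.

End Space.

(** * Two-way transducers and their simulation by two-tape machines *)

(* A two-way finite-state transducer: a read-only input tape, and at each     *)
(* step a word appended to the output.                                        *)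
Section Transducer.
Variables (A Q : finType) (start : Q) (final : pred Q).
Variable delta : Q -> option A -> Q * move * seq A.

Local Notation cell := (option (A + void)).

Record tconfig := TConfig {
  tstate : Q;
  tinput : tape cell;
  toutput : seq A
}.

Definition input_letter (x : cell) : option A :=
  if x is Some (inl a) then Some a else None.

Definition tinit (w : seq A) : tconfig :=
  TConfig start (tape_of None [seq Some (inl a) | a <- w]) [::].

Definition tstep (c : tconfig) : tconfig :=
  if final (tstate c) then c else
  let: (q, m, u) := delta (tstate c) (input_letter (tape_head (tinput c))) in
  TConfig q (tape_move None m (tinput c)) (toutput c ++ u).

Definition max_emit := \max_(x : Q * option A) size (delta x.1 x.2).2.

Lemma size_emit q a : size (delta q a).2 <= max_emit.
Proof. exact: (leq_bigmax (q, a)). Qed.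

(* The letters still to be appended are buffered in the state.                *)
Definition transducer_delta (q : Q * max_emit.-bseq A) (h : {ffun 'I_2 -> cell})
    : (Q * max_emit.-bseq A) * {ffun 'I_2 -> cell * move} :=
  if bseqval q.2 is a :: u then
    ((q.1, insub_bseq max_emit u),
     [ffun i => if i == ord0 then (h ord0, Stay) else (Some (inl a), MoveR)])
  else
    let: (q', m, u) := delta q.1 (input_letter (h ord0)) in
    ((q', insub_bseq max_emit u),
     [ffun i => if i == ord0 then (h ord0, m) else (None, Stay)]).

Definition transducer_tm : tm A :=
  @TM A (Q * max_emit.-bseq A)%type void 1 (start, nil_bseq _ _)
    (fun q => final q.1 && nilp q.2) transducer_delta.

(** The buffer [u] is not yet part of [toutput t]; the output head stands on the blank after the
    letters already written. *)
Definition simulates (u : seq A) (t : tconfig) (c : config transducer_tm) :=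
  [/\ (cfg_state c).1 = tstate t, bseqval (cfg_state c).2 = u,
      cfg_tapes c ord0 = tinput t
    & cfg_tapes c ord_max =
        Tape (rev [seq letter transducer_tm a | a <- toutput t]) None [::]].

Lemma insub_bseqK k (u : seq A) : size u <= k -> bseqval (insub_bseq k u) = u.
Proof. by move=> le_uk; rewrite /insub_bseq insubdK. Qed.

Lemma simulates_flush u q t v c :
  simulates u (TConfig q t v) c ->
  simulates [::] (TConfig q t (v ++ u)) (iter (size u) (@step _ _) c).
Proof.
elim: u v c => [|a u IHu] v c; first by rewrite cats0.
move=> [/= cq cu ct cv]; rewrite -iterS iterSr -cat_rcons; apply: IHu.
have su : size u <= max_emit.
  by have := size_bseq (cfg_state c).2; rewrite /size_bseq cu => /ltnW.
rewrite /step /halted /= /nilp cu andbF /transducer_delta cu.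
split=> //=.
- exact: insub_bseqK.
- by rewrite !ffunE /= ct; case: (t).
- by rewrite !ffunE /= cv map_rcons rev_rcons.
Qed.

(** One machine step loads the buffer, and at most [max_emit] further steps empty it. *)
Lemma simulates_step t c :
  simulates [::] t c -> exists2 k, k <= max_emit.+1 &
    simulates [::] (tstep t) (iter k (@step _ _) c).
Proof.
case: t => q t v [/= cq cu ct cv]; rewrite /tstep /=.
case: ifP => fq; first by exists 0.
case E: (delta _ _) => [[q' m] u].
have su : size u <= max_emit.
  by have := size_emit q (input_letter (tape_head t)); rewrite E.
exists (size u).+1 => //; rewrite iterSr; apply: simulates_flush.
rewrite /step /halted /= cq fq /transducer_delta cu !ffunE ct cq E.
split=> //=.
- exact: insub_bseqK.
- by rewrite !ffunE /= ct; case: (t).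
- by rewrite !ffunE /= cv.
Qed.

Lemma simulates_iter n t c :
  simulates [::] t c -> exists2 k, k <= max_emit.+1 * n &
    simulates [::] (iter n tstep t) (iter k (@step _ _) c).
Proof.
elim: n => [|n IHn] in t c *; first by exists 0.
move=> /simulates_step [k le_k /IHn [k' le_k' sim]].
by exists (k' + k); rewrite ?iterD ?iterSr // mulnS addnC leq_add.
Qed.

Lemma simulates_init w : simulates [::] (tinit w) (init transducer_tm w).
Proof. by split. Qed.

Definition reaches n (c c' : tconfig) := exists2 k, k <= n & iter k tstep c = c'.

Lemma linear_transducer_computable (X Y : Type) (encode : X -> seq A)
    (denotes : seq A -> Y -> Prop) (f : X -> Y) (a b : nat) :
  (forall x, exists c, [/\ reaches (a * size (encode x) + b) (tinit (encode x)) c,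
                           final (tstate c) & denotes (toutput c) (f x)]) ->
  poly_time_space_computable encode denotes f.
Proof.
move=> tf; pose m := max_emit.+1.
(* Each transducer step costs at most [m] machine steps, and the space on two tapes is at most the
   input size plus [2 * T.+1]. *)
exists transducer_tm, ((m * a)%:P * 'X + (m * b)%:P)%R,
  ((2 * m * a + 1)%:P * 'X + (2 * m * b + 2)%:P)%R => x.
have [c [[n le_n cE] fin den]] := tf x.
have [T le_T [Tq Tu _ Tout]] := simulates_iter n (simulates_init (encode x)).
rewrite !(poly.hornerD, poly.hornerMX, poly.hornerC) !natrDE !natrME.
have {}le_T : T <= m * a * size (encode x) + m * b.
  by apply: leq_trans le_T _; rewrite -mulnA -mulnDr leq_mul2l le_n orbT.
have hT : halted (run transducer_tm (encode x) T).
  by rewrite /halted /= Tq cE fin /nilp Tu.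
rewrite cE in Tq Tout; exists T, (toutput c); split=> //.
- move=> k.
  suff: space (run transducer_tm (encode x) k) <= size (encode x) + 2 * T.+1.
    by lia.
  have [/(run_halted hT)-> | /ltnW le_kT] := leqP T k; first exact: space_run.
  by apply: leq_trans (space_run _ _ _) _; rewrite /=; lia.
(* The single trailing blank is the cell under the output head. *)
- exists 0, 1; rewrite /outputs Tout.
  by rewrite /tape_content /= revK.
Qed.

(** * Sweeps of the input head *)

Lemma reaches_refl c : reaches 0 c c.
Proof. by exists 0. Qed.

Lemma reaches_trans n1 n2 n c1 c2 c3 :
  reaches n1 c1 c2 -> reaches n2 c2 c3 -> n1 + n2 <= n -> reaches n c1 c3.
Proof.
move=> [k1 le1 <-] [k2 le2 <-] le_n; exists (k2 + k1); last by rewrite iterD.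
by rewrite addnC; apply: leq_trans le_n; apply: leq_add.
Qed.

Lemma reaches_step n c c' : reaches n (tstep c) c' -> reaches n.+1 c c'.
Proof. by move=> [k le_k <-]; exists k.+1; rewrite ?iterSr. Qed.

Definition cells (w : seq A) : seq cell := [seq Some (inl a) | a <- w].

(* The head reads the first cell of v.                                        *)
Definition tape_at (l v : seq cell) : tape cell :=
  Tape l (head None v) (behead v).

Lemma reaches_scan_right q (g : A -> seq A) w l v out :
  ~~ final q -> {in w, forall a, delta q (Some a) = (q, MoveR, g a)} ->
  reaches (size w)
    (TConfig q (tape_at l (cells w ++ v)) out)
    (TConfig q (tape_at (rev (cells w) ++ l) v) (out ++ flatten (map g w))).
Proof.
move=> nfq; elim: w => [|a w IHw] in l out * => qg.
  by rewrite cats0; apply: reaches_refl.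
apply: reaches_step; rewrite /tstep /= (negPf nfq) qg ?mem_head // /cells /=.
rewrite rev_cons cat_rcons catA; apply: IHw => b bw.
by rewrite qg // inE bw orbT.
Qed.

Lemma reaches_scan_left q w l v out :
  ~~ final q -> {in w, forall a, delta q (Some a) = (q, MoveL, [::])} ->
  0 < size v ->
  reaches (size w)
    (TConfig q (tape_move None MoveL (tape_at (rev (cells w) ++ l) v)) out)
    (TConfig q (tape_move None MoveL (tape_at l (cells w ++ v))) out).
Proof.
move=> nfq; elim/last_ind: w => [|w a IHw] in v * => qw v_gt0.
  exact: reaches_refl.
rewrite size_rcons /cells map_rcons rev_rcons cat_rcons -/(cells w).
apply: reaches_step; rewrite /tstep /= (negPf nfq) qw ?mem_rcons ?mem_head //.
rewrite cats0; have -> : head None v :: behead v = v by case: (v) v_gt0.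
by apply: (IHw (Some (inl a) :: v)) => // b bw; rewrite qw // mem_rcons inE bw orbT.
Qed.

End Transducer.

(** * The transducer of the reduction *)

Variant phase :=
  | Scan of bool | CopyPos of bool | Back of bool | CopyNeg of bool
  | Rewind of bool | Fresh | Clause | Done.

Definition phase_code (q : phase) : bool + bool + bool + bool + bool + option bool :=
  match q with
  | Scan m => inl (inl (inl (inl (inl m)))) | CopyPos m => inl (inl (inl (inl (inr m))))
  | Back m => inl (inl (inl (inr m))) | CopyNeg m => inl (inl (inr m))
  | Rewind m => inl (inr m)
  | Fresh => inr None | Clause => inr (Some true) | Done => inr (Some false)
  end.

Definition phase_decode (c : bool + bool + bool + bool + bool + option bool) : phase :=
  match c with
  | inl (inl (inl (inl (inl m)))) => Scan m | inl (inl (inl (inl (inr m)))) => CopyPos m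
  | inl (inl (inl (inr m))) => Back m | inl (inl (inr m)) => CopyNeg m
  | inl (inr m) => Rewind m
  | inr None => Fresh | inr (Some true) => Clause | inr (Some false) => Done
  end.

Lemma phase_codeK : cancel phase_code phase_decode.
Proof. by case. Qed.

HB.instance Definition _ := Finite.copy phase (can_type phase_codeK).

Definition is_done (q : phase) := if q is Done then true else false.

(** A leading [true] keeps literal vertices apart from the source and the sink. *)
Definition source_vertex : ident := [::].
Definition sink_vertex : ident := [:: false].
Definition literal_vertex (l : literal) : ident := true :: l.1 :: l.2.

(* The input is read three times.  The passes [Scan false] and [Scan true]    *)
(* write, for each literal over x, the two literal vertices of x (going back  *)
(* over x for the second one): the former to list the vertices, the latter to *)
(* form the hyperedge of x.  The last pass writes the hyperedges of the       *)
(* clauses.                                                                   *)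
Definition reduction_delta (q : phase) (a : option symbol) :
    phase * move * seq symbol :=
  match q, a with
  | Scan m, Some (Sign _) =>
      (CopyPos m, MoveR,
       (if m then flatten [seq vertex_word v | v <- [:: sink_vertex; sink_vertex]]
        else [::]) ++ [:: Vertex; Bit true; Bit true])
  | Scan m, Some _ => (Scan m, MoveR, [::])
  | Scan m, None =>
      (Rewind m, MoveL,
       if m then [::] else
       vertices_word [:: source_vertex; sink_vertex] ++
       vertices_word [:: source_vertex; sink_vertex])
  | CopyPos m, Some (Bit b) => (CopyPos m, MoveR, [:: Bit b])
  | CopyPos m, _ => (Back m, MoveL, [:: Vertex; Bit true; Bit false])
  | Back m, Some (Bit _) => (Back m, MoveL, [::])
  | Back m, _ => (CopyNeg m, MoveR, [::])
  | CopyNeg m, Some (Bit b) => (CopyNeg m, MoveR, [:: Bit b])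
  | CopyNeg m, _ => (Scan m, Stay, if m then [:: Sep] else [::])
  | Rewind m, Some _ => (Rewind m, MoveL, [::])
  | Rewind m, None => (if m then Fresh else Scan true, MoveR, [::])
  | Fresh, Some _ =>
      (Clause, Stay,
       flatten [seq vertex_word v | v <- [:: source_vertex; source_vertex]])
  | Clause, Some (Sign b) => (Clause, MoveR, [:: Vertex; Bit true; Bit b])
  | Clause, Some (Bit b) => (Clause, MoveR, [:: Bit b])
  | Clause, Some Sep => (Fresh, MoveR, [:: Sep])
  | _, _ => (Done, Stay, [::])
  end.

Notation red_reaches := (reaches is_done reduction_delta).

Definition literal_vertices (p : literal) : seq ident :=
  [:: literal_vertex (true, p.2); literal_vertex (false, p.2)].

Definition consistency_edge (p : literal) : seq ident :=
  sink_vertex :: literal_vertices p.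

(** In the hyperedge the sink is written twice: as its needy node, then as a member. *)
Definition double_word (m : bool) (p : literal) : seq symbol :=
  if m then vertices_word (sink_vertex :: consistency_edge p)
  else flatten (map vertex_word (literal_vertices p)).

Definition clause_edge (c : clause) : seq ident :=
  source_vertex :: map literal_vertex c.

Lemma flatten_map_Bit (x : seq bool) (g : symbol -> seq symbol) :
  (forall b, g (Bit b) = [:: Bit b]) -> flatten (map g (map Bit x)) = map Bit x.
Proof. by move=> gB; elim: x => //= b x ->; rewrite gB. Qed.

(** The sign and the non-bit [a] delimit the name on both sides, so each run over it stops in time.
    The cost is three traversals of the name and four single steps. *)
Lemma scan_literal m p a l v out : (forall b, a <> Bit b) ->
  red_reaches (4 * size (literal_word p))
    (TConfig (Scan m) (tape_at l (cells (literal_word p) ++ Some (inl a) :: v)) out)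
    (TConfig (Scan m)
       (tape_at (rev (cells (literal_word p)) ++ l) (Some (inl a) :: v))
       (out ++ double_word m p)).
Proof.
move=> a_bit; case: p => b x; rewrite /literal_word /=.
have copy q l' v' out' :
    (forall c, reduction_delta q (Some (Bit c)) = (q, MoveR, [:: Bit c])) ->
    ~~ is_done q ->
    red_reaches (size x)
      (TConfig q (tape_at l' (cells (map Bit x) ++ v')) out')
      (TConfig q (tape_at (rev (cells (map Bit x)) ++ l') v') (out' ++ map Bit x)).
  move=> qB nd; rewrite -(size_map Bit).
  rewrite -[X in out' ++ X](@flatten_map_Bit x (fun s => [:: s])) //.
  by apply: reaches_scan_right => // _ /mapP[c _ ->].
set s := Some (inl (Sign b)); rewrite size_map.
pose out1 := out ++ ((if m then
  flatten [seq vertex_word v | v <- [:: sink_vertex; sink_vertex]] else [::])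
   ++ [:: Vertex; Bit true; Bit true]) ++ map Bit x.
pose out2 := out1 ++ [:: Vertex; Bit true; Bit false].
apply: (@reaches_trans _ _ _ _ (1 + size x + 1) (2 * size x + 2) _ _
  (TConfig (Back m) (tape_move None MoveL
     (tape_at (rev (cells (map Bit x)) ++ s :: l) (Some (inl a) :: v))) out2));
  last by lia.
  rewrite -addnA; apply: reaches_step.
  apply: (reaches_trans (copy (CopyPos m) _ _ _ _ _)) => //.
  apply: reaches_step; rewrite /out2 /out1 !catA /tstep /=.
  by case: a a_bit => [c /(_ c)|c _|_|_] //; exact: reaches_refl.
apply: (@reaches_trans _ _ _ _ (size x) (size x + 2) _ _
  (TConfig (Back m) (tape_move None MoveL
     (tape_at (s :: l) (cells (map Bit x) ++ Some (inl a) :: v))) out2)); last by lia.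
  rewrite -{1}(size_map Bit); apply: reaches_scan_left => // _ /mapP[c _ ->] //.
rewrite addnC; apply: reaches_step; rewrite /tstep /= cats0.
apply: (@reaches_trans _ _ _ _ (size x) 1 _ _ _ _
  (copy (CopyNeg m) (s :: l) (Some (inl a) :: v) out2 _ _)) => //; last by lia.
have outE : (out2 ++ map Bit x) ++ (if m then [:: Sep] else [::]) =
          out ++ double_word m (b, x).
  rewrite /out2 /out1 /double_word; case: (m) => /=.
    by rewrite /vertices_word /= -?catA /= -?catA.
  by rewrite -?catA /= -?catA.
rewrite rev_cons cat_rcons -outE; apply: reaches_step.
by case: a a_bit => [c /(_ c)|c _|_|_] //; exact: reaches_refl.
Qed.

Lemma cells_cat (A : finType) (w1 w2 : seq A) :
  cells (w1 ++ w2) = cells w1 ++ cells w2.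
Proof. exact: map_cat. Qed.

Lemma scan_clause m c l v out :
  red_reaches (4 * size (clause_word c))
    (TConfig (Scan m) (tape_at l (cells (clause_word c) ++ v)) out)
    (TConfig (Scan m) (tape_at (rev (cells (clause_word c)) ++ l) v)
       (out ++ flatten (map (double_word m) c))).
Proof.
elim: c => [|p c IHc] in l out *.
  by exists 1 => //; rewrite /= /tstep /= !cats0.
have -> : clause_word (p :: c) = literal_word p ++ clause_word c.
  by rewrite /clause_word /= catA.
rewrite cells_cat rev_cat -!catA size_cat.
(* The rest of the clause begins with a sign or the separator, so it delimits the preceding name. *)
have [a [u [cE a_bit]]] : exists a u, clause_word c = a :: u /\ forall b, a <> Bit b.
  by case: (c) => [|p' c']; eexists; eexists; split; try exact: erefl.
have := scan_literal m p l (cells u ++ v) out a_bit.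
rewrite -[_ :: _]/(cells (a :: u) ++ v) -cE => scan_p.
have -> : flatten (map (double_word m) (p :: c)) =
          double_word m p ++ flatten (map (double_word m) c) by [].
by rewrite [out ++ _]catA; apply: (reaches_trans scan_p (IHc _ _)); rewrite mulnDr.
Qed.

Lemma scan_cnf m phi l v out :
  red_reaches (4 * size (cnf_word phi))
    (TConfig (Scan m) (tape_at l (cells (cnf_word phi) ++ v)) out)
    (TConfig (Scan m) (tape_at (rev (cells (cnf_word phi)) ++ l) v)
       (out ++ flatten [seq double_word m p | p <- flatten phi])).
Proof.
elim: phi => [|c phi IHphi] in l out *.
  by rewrite cats0; exact: reaches_refl.
rewrite /cnf_word /= -/(cnf_word phi) size_cat cells_cat rev_cat -!catA.
rewrite map_cat flatten_cat [out ++ _]catA.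
by apply: (reaches_trans (scan_clause _ _ _ _ _) (IHphi _ _)); rewrite mulnDr.
Qed.

(* The blank to the left of the input is on the tape only once visited, that  *)
(* is, from the second pass on: this is what k records.                       *)
Lemma rewind_cells m w k out :
  red_reaches (size w).+1
    (TConfig (Rewind m)
       (tape_move None MoveL (tape_at (rev (cells w) ++ nseq (k : bool) None) [::]))
       out)
    (TConfig (if m then Fresh else Scan true)
       (tape_at [:: None] (cells w ++ [:: None])) out).
Proof.
apply: (@reaches_trans _ _ _ _ (size w) 1 _ _ _ _
  (@reaches_scan_left _ _ is_done reduction_delta (Rewind m) w
     (nseq k None) [:: None] out _ _ _)) => //; last by rewrite addn1.
by exists 1; rewrite //= /tstep; case: k => /=; rewrite cats0; case: w.
Qed.

Lemma write_clause c l v out :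
  red_reaches (2 * size (clause_word c))
    (TConfig Fresh (tape_at l (cells (clause_word c) ++ v)) out)
    (TConfig Fresh (tape_at (rev (cells (clause_word c)) ++ l) v)
       (out ++ vertices_word (source_vertex :: clause_edge c))).
Proof.
pose g a := if a is Sign b then [:: Vertex; Bit true; Bit b] else [:: a].
pose w := flatten (map literal_word c).
have wE : clause_word c = rcons w Sep by rewrite -cats1.
have gE : flatten (map g w) = flatten [seq vertex_word (literal_vertex p) | p <- c].
  rewrite /w; elim: (c) => //= -[b x] c' IHc /=.
  by rewrite map_cat flatten_cat flatten_map_Bit // IHc.
rewrite wE size_rcons /cells map_rcons rev_rcons cat_rcons -/(cells w).
pose out1 := out ++ flatten [seq vertex_word u | u <- [:: source_vertex; source_vertex]].
apply: (@reaches_trans _ _ _ _ 1 (size w + 1) _ _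
  (TConfig Clause (tape_at l (cells w ++ Some (inl Sep) :: v)) out1)); last by lia.
  exists 1 => //=; rewrite /tstep /=.
  by case: (w).
have w_lit a : a \in w -> reduction_delta Clause (Some a) = (Clause, MoveR, g a).
  by move/flattenP=> [_ /mapP[p _ ->]]; rewrite inE => /orP[/eqP->|/mapP[b _ ->]].
apply: (@reaches_trans _ _ _ _ (size w) 1 _ _ _ _
  (@reaches_scan_right _ _ is_done reduction_delta Clause g w l
     (Some (inl Sep) :: v) out1 _ _)) => //.
exists 1 => //; rewrite /= /tstep /= /vertices_word /out1 gE.
by rewrite /clause_edge /= -map_comp -!catA.
Qed.

Lemma write_cnf phi l v out :
  red_reaches (2 * size (cnf_word phi))
    (TConfig Fresh (tape_at l (cells (cnf_word phi) ++ v)) out)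
    (TConfig Fresh (tape_at (rev (cells (cnf_word phi)) ++ l) v)
       (out ++ flatten [seq vertices_word (source_vertex :: clause_edge c) | c <- phi])).
Proof.
elim: phi => [|c phi IHphi] in l out *.
  by rewrite cats0; exact: reaches_refl.
rewrite -[cnf_word _]/(clause_word c ++ cnf_word phi).
rewrite size_cat cells_cat rev_cat map_cons -cat1s flatten_cat [flatten [:: _]]cats0.
rewrite -(catA (cells _)) -(catA (rev _)) [out ++ _]catA.
by apply: (reaches_trans (write_clause _ _ _ _) (IHphi _ _)); rewrite mulnDr.
Qed.

Definition reduction_word (phi : cnf) : seq symbol :=
  flatten [seq double_word false p | p <- flatten phi] ++
  vertices_word [:: source_vertex; sink_vertex] ++
  vertices_word [:: source_vertex; sink_vertex] ++
  flatten [seq double_word true p | p <- flatten phi] ++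
  flatten [seq vertices_word (source_vertex :: clause_edge c) | c <- phi].

(** The two scanning passes cost at most [5 * size w + 2] each, rewinding included, and the clause
    pass at most [2 * size w + 2]. *)
Lemma reduction_run phi :
  exists c, [/\ red_reaches (12 * size (cnf_word phi) + 6)
                  (tinit (Scan false) (cnf_word phi)) c,
                is_done (tstate c) & toutput c = reduction_word phi].
Proof.
set w := cnf_word phi.
exists (TConfig Done (tape_at (rev (cells w) ++ [:: None]) [:: None])
  (reduction_word phi)); split=> //.
(* The condition on [v] admits [[::]] (first pass) and [[:: None]] (second pass), which give the
   same tape. *)
have pass m (k : bool) v out :
    tape_at (rev (cells w) ++ nseq k None) v =
      tape_at (rev (cells w) ++ nseq k None) [::] ->
    red_reaches (5 * size w + 2)
      (TConfig (Scan m) (tape_at (nseq k None) (cells w ++ v)) out)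
      (TConfig (if m then Fresh else Scan true)
         (tape_at [:: None] (cells w ++ [:: None]))
         (out ++ flatten [seq double_word m p | p <- flatten phi] ++
          if m then [::] else vertices_word [:: source_vertex; sink_vertex] ++
                              vertices_word [:: source_vertex; sink_vertex])).
  move=> vE; apply: (reaches_trans (scan_cnf m phi _ _ _) (reaches_step _)).
    by rewrite vE /tstep /= -catA; exact: rewind_cells.
  by rewrite -[leqLHS]/(4 * size w + (size w).+2); lia.
have := pass false false [::] [::] erefl; rewrite cats0 => pass1.
apply: (reaches_trans pass1 (n2 := 7 * size w + 4)); last by lia.
apply: (@reaches_trans _ _ _ _ (5 * size w + 2) (2 * size w + 2) _ _ _ _
  (pass true true [:: None] _ erefl)); last by lia.
apply: (@reaches_trans _ _ _ _ (2 * size w) 2 _ _ _ _ (write_cnf phi _ _ _)) => //.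
exists 1 => //; rewrite /= /tstep /= !cats0 /reduction_word.
by rewrite -!catA.
Qed.

(** * The instance built from a formula *)

Local Open Scope fset_scope.

Lemma in_vertex_set v vs : (v \in vertex_set vs) = (v \in vs).
Proof. by rewrite inE. Qed.

Section Reduction.
Variable phi : cnf.

Definition reduction_vertices : seq ident :=
  flatten (map literal_vertices (flatten phi)) ++ [:: source_vertex; sink_vertex].

Definition reduction_edges : seq (ident * seq ident) :=
  [seq (sink_vertex, consistency_edge p) | p <- flatten phi] ++
  [seq (source_vertex, clause_edge c) | c <- phi].

Definition reduction_needy (e : {fset ident}) : ident :=
  if source_vertex \in e then source_vertex else sink_vertex.

Lemma literal_vertices_sub p b :
  p \in flatten phi -> literal_vertex (b, p.2) \in reduction_vertices.
Proof.
move=> pphi; rewrite mem_cat; apply/orP; left; apply/flattenP.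
exists (literal_vertices p); first exact: map_f.
by case: b; rewrite !inE eqxx ?orbT.
Qed.

Lemma source_in_reduction : source_vertex \in reduction_vertices.
Proof. by rewrite mem_cat !inE eqxx orbT. Qed.

Lemma sink_in_reduction : sink_vertex \in reduction_vertices.
Proof. by rewrite mem_cat !inE eqxx !orbT. Qed.

Lemma reduction_edges_sub e v :
  e \in reduction_edges -> v \in e.2 -> v \in reduction_vertices.
Proof.
rewrite mem_cat => /orP[] /mapP[x xphi ->]; rewrite inE => /orP[/eqP->|].
- exact: sink_in_reduction.
- by rewrite !inE => /orP[] /eqP->; exact: literal_vertices_sub.
- exact: source_in_reduction.
- move=> /mapP[[b y] px ->]; apply: (@literal_vertices_sub (b, y)).
  by apply/flattenP; exists x.
Qed.

Lemma reduction_needyE :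
  {in reduction_edges, forall e, reduction_needy (vertex_set e.2) = e.1}.
Proof.
move=> e; rewrite mem_cat => /orP[] /mapP[x _ ->];
  by rewrite /reduction_needy in_vertex_set !inE.
Qed.

Lemma needy_mem_edge e : e \in reduction_edges -> e.1 \in e.2.
Proof. by rewrite mem_cat => /orP[] /mapP[x _ ->]; rewrite inE eqxx. Qed.

Lemma reduction_fsub e :
  e \in [fset vertex_set e.2 | e : ident * seq ident in reduction_edges] ->
  e `<=` vertex_set reduction_vertices.
Proof.
move=> /imfsetP[/= x xE ->]; apply/fsubsetP => v; rewrite !in_vertex_set.
exact: reduction_edges_sub.
Qed.

Lemma reduction_needy_in e :
  e \in [fset vertex_set e.2 | e : ident * seq ident in reduction_edges] ->
  reduction_needy e \in e.
Proof.
move=> /imfsetP[/= x xE ->]; rewrite reduction_needyE // in_vertex_set.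
exact: needy_mem_edge.
Qed.

Lemma source_in_fset : source_vertex \in vertex_set reduction_vertices.
Proof. by rewrite in_vertex_set source_in_reduction. Qed.

Lemma sink_in_fset : sink_vertex \in vertex_set reduction_vertices.
Proof. by rewrite in_vertex_set sink_in_reduction. Qed.

Definition reduction : needy_instance :=
  @NeedyInstance (vertex_set reduction_vertices)
    [fset vertex_set e.2 | e : ident * seq ident in reduction_edges]
    source_vertex sink_vertex reduction_needy
    reduction_fsub source_in_fset sink_in_fset isT reduction_needy_in.

Lemma reduction_word_denotes : denotes_instance (reduction_word phi) reduction.
Proof.
exists reduction_vertices, reduction_edges; split=> //; last exact: reduction_needyE.
(* The first pass leaves the vertex list open; the first copy of source and sink completes and
   closes it. *)
have -> : vertices_word reduction_vertices =
    flatten [seq double_word false p | p <- flatten phi] ++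
    vertices_word [:: source_vertex; sink_vertex].
  rewrite {1}/vertices_word map_cat flatten_cat -catA; congr (_ ++ _).
  by elim: (flatten phi) => //= p ps ->; rewrite /= cats0 -catA.
by rewrite /reduction_edges map_cat flatten_cat -!map_comp -(catA _ (vertices_word _)).
Qed.

End Reduction.

(** * Cuts of value zero and satisfying assignments *)

Lemma bigmin_eq0 (I : Type) (r : seq I) (P : pred I) (F : I -> nat) (d : nat) :
  (\big[minn/d]_(i <- r | P i) F i == 0) =
  (d == 0) || has (fun i => P i && (F i == 0)) r.
Proof.
elim: r => [|i r IHr]; first by rewrite big_nil orbF.
rewrite big_cons /=; case: (P i) => //=.
by rewrite orbCA -IHr; lia.
Qed.

Lemma min_cut_value_eq0 (I : needy_instance) :
  min_cut_value I = 0 <->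
  exists S : {fset ident},
    [/\ source I \in S, sink I \notin S
      & {in edges I, forall e, splitting I e (e `&` S) = 0}].
Proof.
have cut0 S : reflect {in edges I, forall e, splitting I e (e `&` S) = 0}
                      (cut_value I S == 0).
  rewrite /cut_value sum_nat_seq_eq0.
  by apply: (iffP allP) => h e eI; apply/eqP; exact: h.
split=> [/eqP | [S [sS tS S0]]].
  rewrite /min_cut_value bigmin_eq0.
  move=> /orP[/cut0 S0 | /hasP[S _ /andP[/andP[sS tS] /cut0 S0]]].
    (* The default value belongs to a feasible set, so it is a legitimate witness. *)
    by exists [fset source I]; rewrite !inE eqxx eq_sym source_neq_sink.
  by exists S.
apply/eqP; rewrite /min_cut_value bigmin_eq0; apply/orP; right; apply/hasP.
(* Restricting [S] to the vertices does not change its trace on any hyperedge. *)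
exists (vertices I `&` S); first by rewrite fpowersetE fsubsetIl.
rewrite !inE source_in sS sink_in tS /=; apply/cut0 => e eI.
by rewrite fsetIA (fsetIidPl (edges_sub eI)) S0.
Qed.

Lemma reduction_correct phi :
  min_cut_value (reduction phi) = 0 <-> satisfiable phi.
Proof.
rewrite min_cut_value_eq0; split=> [[S [/= sS tS S0]] | [a phia]].
  have noncut e : e \in reduction_edges phi ->
      (vertex_set e.2 `&` S != [fset e.1]) &&
      (vertex_set e.2 `\` (vertex_set e.2 `&` S) != [fset e.1]).
    move=> eE; have := S0 (vertex_set e.2); rewrite /splitting /= (reduction_needyE eE).
    rewrite -negb_or -eqb0 => -> //.
    by apply/imfsetP; exists e.
  exists (fun x => literal_vertex (true, x) \in S); apply/allP => c cphi.
  have /noncut/andP[/eqP cS _] : (source_vertex, clause_edge c) \in reduction_edges phi.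
    by rewrite mem_cat; apply/orP; right; apply: map_f.
  (* If all literals of [c] were false, [S] would meet its hyperedge in the source alone. *)
  apply: contraT => /hasPn noS; case: cS; apply/fsetP => v.
  rewrite in_fset1 in_fsetI in_vertex_set inE.
  have [->|_ /=] := eqVneq v source_vertex; first by rewrite sS.
  apply/negbTE/negP => /andP[/mapP[[b x] pc ->] vS].
  have := noS _ pc => /=; case: b pc vS => pc vS; first by rewrite vS.
  rewrite eqbF_neg negbK => xS.
  have pphi : (false, x) \in flatten phi by apply/flattenP; exists c.
  (* With x and its negation both in [S], only the sink of this hyperedge would be outside. *)
  have /noncut/andP[_ /eqP[]] :
      (sink_vertex, consistency_edge (false, x)) \in reduction_edges phi.
    by rewrite mem_cat map_f.
  apply/fsetP => u; rewrite in_fset1 in_fsetD in_fsetI in_vertex_set !inE.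
  have [->|_ /=] := eqVneq u sink_vertex; first by rewrite (negPf tS).
  apply/negbTE; case: eqVneq => [->|_] /=; first by rewrite xS.
  by case: eqVneq => [->|] //; rewrite vS.
pose good (v : ident) :=
  match v with [::] => true | true :: b :: x => a x == b | _ => false end.
pose S := [fset v in reduction_vertices phi | good v].
have inS v : (v \in S) = (v \in reduction_vertices phi) && good v by rewrite !inE.
exists S; split; rewrite ?inS ?source_in_reduction ?andbF //.
move=> _ /imfsetP[/= e eE ->]; rewrite /splitting /= (reduction_needyE eE).
apply/eqP; rewrite eqb0 negb_or.
move: eE; rewrite mem_cat => /orP[] /mapP[x xphi ->] /=;
  apply/andP; split; apply/eqP => /fsetP eS.
- by have := eS sink_vertex; rewrite in_fset1 eqxx in_fsetI inS !andbF.
(* The false literal of the variable accompanies the sink outside [S]. *)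
- have := eS (literal_vertex (~~ a x.2, x.2)).
  rewrite in_fset1 in_fsetD in_fsetI inS in_vertex_set /=.
  by case: (a _); rewrite /= !inE eqxx ?orbT !andbF.
- have /hasP[p px ap] := allP phia x xphi.
  have pe : literal_vertex p \in clause_edge x by rewrite inE map_f ?orbT.
  have pV : literal_vertex p \in reduction_vertices phi.
    apply: (@reduction_edges_sub _ (source_vertex, clause_edge x)) pe.
    rewrite mem_cat; apply/orP; right.
    exact: (map_f (fun c => (source_vertex, clause_edge c))).
  have := eS (literal_vertex p).
  by rewrite in_fset1 in_fsetI inS in_vertex_set pe pV /= ap.
- have := eS source_vertex.
  rewrite in_fset1 eqxx in_fsetD in_fsetI inS in_vertex_set source_in_reduction.
  by rewrite inE eqxx.
Qed.

Theorem theorem5p5 :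
  exists f : cnf -> needy_instance,
    poly_time_space_computable cnf_word denotes_instance f /\
    forall phi : cnf, min_cut_value (f phi) = 0 <-> satisfiable phi.
Proof.
exists reduction; split; last exact: reduction_correct.
apply: (@linear_transducer_computable _ _ (Scan false) is_done reduction_delta
  _ _ _ _ _ 12 6) => phi.
have [c [run_c c_done cE]] := reduction_run phi.
by exists c; rewrite cE; split=> //; exact: reduction_word_denotes.
Qed.
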